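(* Let $\mathbb{H}$ be a complex Hilbert space and let $T\in\mathbb{B}(\mathbb{H})$. Then $$\omega(T)\le\frac12\sqrt{\sqrt2\,\omega\left(|T|^2+\mathrm{i}|T^*|^2\right)+2\,\omega(T^2)}.$$
   Context: $\mathbb{B}(\mathbb{H})$ is the algebra of bounded linear operators on $\mathbb{H}$, $|T|=(T^*T)^{1/2}$, $\mathrm{i}$ is the imaginary unit, and $\omega(T)=\sup_{\|x\|=1}|\langle Tx,x\rangle|$ is the numerical radius. *)

(* Defs.v *)
From HB Require Import structures.
From mathcomp Require Import all_boot all_order all_algebra.
From mathcomp Require Import complex.
From mathcomp Require Import all_classical all_reals all_analysis.

Set Implicit Arguments.
Unset Strict Implicit.
Unset Printing Implicit Defensive.

Import Order.TTheory GRing.Theory Num.Theory.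
Import numFieldNormedType.Exports.

Local Open Scope classical_set_scope.
Local Open Scope ring_scope.
Local Open Scope complex_scope.

(* The inner product is linear in its first argument; it induces the norm,
   for which the space is complete. *)
HB.mixin Record isHilbert (R : realType) H of CompleteNormedModule R[i] H := {
  hdot : {dot H for Num.conj} ;
  hdotE : forall x : H, hdot x x = `|x| ^+ 2
}.

#[short(type="hilbertType")]
HB.structure Definition Hilbert (R : realType) :=
  { H of isHilbert R H & CompleteNormedModule R[i] H }.

Section Operators.
Context {R : realType} {H : hilbertType R}.
Implicit Types S T A : H -> H.

Definition bounded_operator T : Prop :=
  linear T /\ bounded_near T (nbhs (0 : H)).

Definition is_adjoint T S : Prop :=
  bounded_operator S /\ forall x y : H, hdot (T x) y = hdot x (S y).

(* By the Riesz representation theorem, every bounded operator has exactly one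
   adjoint, so that [get] never returns its default value on such a T. *)
Definition adjoint T : H -> H := get [set S | is_adjoint T S].

(* In R[i], [0 <= z] means that z is real and nonnegative. *)
Definition positive_operator A : Prop :=
  bounded_operator A /\ forall x : H, 0 <= hdot (A x) x.

(* Every positive operator has exactly one positive square root, so that [get]
   never returns its default value on such an A. *)
Definition sqrt_operator A : H -> H :=
  get [set S | positive_operator S /\ S \o S = A].

Definition abs_operator T : H -> H := sqrt_operator (adjoint T \o T).

(* [complex.Re] turns the modulus, an element of R[i], into an element of R.
   If H is the zero space, the supremum is [sup set0 = 0]. *)
Definition numerical_radius T : R :=
  sup [set complex.Re `|hdot (T x) x| | x in [set x : H | `|x| = 1]].

End Operators.

(* Main.v *)
Require Import Defs.
From HB Require Import structures.
From mathcomp Require Import all_boot all_order all_algebra.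
From mathcomp Require Import complex ring lra.
From mathcomp Require Import all_classical all_reals all_analysis.
Import Order.TTheory GRing.Theory Num.Theory.
Import numFieldNormedType.Exports.
Local Open Scope ring_scope.

(** Let x be a unit vector. Buzano's inequality
      |<a, e>| |<e, b>| <= (|a| |b| + |<a, b>|) / 2       (|e| = 1)
    with a = T x, b = T* x and e = x reads
      2 |<T x, x>|^2 <= |T x| |T* x| + |<T^2 x, x>|.
    Here |T x|^2 = <|T|^2 x, x> = p and |T* x|^2 = <|T*|^2 x, x> = q are
    real, so that 2 |T x| |T* x| <= p + q <= sqrt 2 |p + i q|, where p + i q is
    the quadratic form of |T|^2 + i |T*|^2 at x. Bounding both quadratic forms
    by numerical radii and taking the supremum over x gives the theorem
    ([buzano], [add_le_cmod]).

    The operators T* and |T| are defined by choice, so that the identity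
    |T|^2 = T* T used above amounts to two existence theorems.

    - The adjoint ([adjoint_exists]) comes from Riesz representation, obtained
      by minimizing |z|^2 - 2 f z. A first-order variation shows that an
      almost-minimizer z satisfies |<z, h> - f h| <= e |h| for all h; this
      makes a minimizing sequence Cauchy and its limit represent f.

    - The square root of T* T ([square_root_exists]) is M (1 - Y), where M
      bounds T and Y solves 2 Y = B + Y^2 for the contraction
      B = 1 - T* T / M^2. The iterates Y_(n+1) = (B + Y_n^2) / 2 are compared
      with the real numbers t_(n+1) = (1 + t_n^2) / 2, the same recursion with
      B replaced by 1: the increments of Y_n are at most those of t_n in norm,
      and t_n is increasing and bounded.

    Norms, moduli and inner products take values in the complex field, whose
    order is only partial; estimates are therefore made with their real parts
    [rnorm], [cmod] and [rdot]. *)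

(** * The underlying real inner product space *)

Section RealGeometry.
Context {R : realType} {H : hilbertType R}.
Implicit Types (x y z : H) (T : H -> H).

Definition rnorm x : R := complex.Re `|x|.
Definition rdot x y : R := complex.Re (hdot x y).
Definition cmod (z : R[i]) : R := complex.Re `|z|.

Lemma cmodE (z : R[i]) : `|z| = (cmod z)%:C%C.
Proof. by rewrite /cmod normc_def. Qed.

Lemma rnormE x : `|x| = (rnorm x)%:C%C.
Proof. by rewrite /rnorm RRe_real// normr_real. Qed.

Lemma hdotC x y : hdot y x = ((hdot x y)^*)%C.
Proof. by rewrite hermC expr0 mul1r. Qed.

Lemma hdotDl x y z : hdot (x + y) z = hdot x z + hdot y z.
Proof. exact: linearDl. Qed.
Lemma hdotZl a x z : hdot (a *: x) z = a * hdot x z.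
Proof. exact: linearZl_LR. Qed.
Lemma hdotZr a x z : hdot x (a *: z) = (a^*)%C * hdot x z.
Proof. exact: linearZr_LR. Qed.

Lemma ReM_real (a : R) (z : R[i]) : complex.Re (a%:C%C * z) = a * complex.Re z.
Proof. by case: z => u v /=; rewrite mul0r subr0. Qed.

Lemma rdotC x y : rdot x y = rdot y x.
Proof. by rewrite /rdot (hdotC y x); case: (hdot y x). Qed.

Lemma rdotDl x y z : rdot (x + y) z = rdot x z + rdot y z.
Proof. by rewrite /rdot hdotDl raddfD. Qed.

Lemma rdotZl (a : R) x z : rdot (a%:C%C *: x) z = a * rdot x z.
Proof. by rewrite /rdot hdotZl ReM_real. Qed.

Lemma rdotNl x z : rdot (- x) z = - rdot x z.
Proof. by rewrite /rdot linearNl raddfN. Qed.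

Lemma rdotBl x y z : rdot (x - y) z = rdot x z - rdot y z.
Proof. by rewrite rdotDl rdotNl. Qed.

Lemma rdotDr x y z : rdot z (x + y) = rdot z x + rdot z y.
Proof. by rewrite !(rdotC z) rdotDl. Qed.

Lemma rdotZr (a : R) x z : rdot z (a%:C%C *: x) = a * rdot z x.
Proof. by rewrite !(rdotC z) rdotZl. Qed.

Lemma rdotBr x y z : rdot z (x - y) = rdot z x - rdot z y.
Proof. by rewrite !(rdotC z) rdotBl. Qed.

Lemma hdotxx x : hdot x x = (rnorm x ^+ 2)%:C%C.
Proof. by rewrite hdotE rnormE -rmorphXn. Qed.

Lemma rdotxx x : rdot x x = rnorm x ^+ 2.
Proof. by rewrite /rdot hdotxx. Qed.

Lemma rnorm_ge0 x : 0 <= rnorm x.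
Proof. by rewrite -ler0c -rnormE. Qed.

Lemma rnorm_eq0 x : rnorm x = 0 -> x = 0.
Proof. by move=> x0; apply/normr0_eq0; rewrite rnormE x0. Qed.

Lemma rnorm0 : rnorm 0 = 0.
Proof. by rewrite /rnorm normr0. Qed.

Lemma rnormZ a x : rnorm (a *: x) = cmod a * rnorm x.
Proof. by rewrite {1}/rnorm normrZ cmodE ReM_real. Qed.

Lemma rnormD x y : rnorm (x + y) <= rnorm x + rnorm y.
Proof. by rewrite -lecR rmorphD/= -!rnormE ler_normD. Qed.

Lemma rnormN x : rnorm (- x) = rnorm x.
Proof. by rewrite /rnorm normrN. Qed.

Lemma rnormBC x y : rnorm (x - y) = rnorm (y - x).
Proof. by rewrite -rnormN opprB. Qed.

Lemma cmod_real (a : R) : 0 <= a -> cmod a%:C%C = a.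
Proof. by move=> a0; rewrite /cmod ger0_norm// ler0c. Qed.

Lemma cmod_ge0 (z : R[i]) : 0 <= cmod z.
Proof. by rewrite -ler0c -cmodE. Qed.

Lemma cmodM (z w : R[i]) : cmod (z * w) = cmod z * cmod w.
Proof. by rewrite {1}/cmod normrM cmodE ReM_real. Qed.

Lemma cmodD (z w : R[i]) : cmod (z + w) <= cmod z + cmod w.
Proof. by rewrite -lecR rmorphD/= -!cmodE ler_normD. Qed.

Lemma cmodJ (z : R[i]) : cmod (z^*)%C = cmod z.
Proof. by rewrite /cmod normcJ. Qed.

Lemma sqr_cmod (z : R[i]) : cmod z ^+ 2 = complex.Re z ^+ 2 + complex.Im z ^+ 2.
Proof.
by rewrite /cmod normc_def /= sqr_sqrtr// addr_ge0// sqr_ge0.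
Qed.

(** Cauchy-Schwarz: expanding 0 <= | |y| x - |x| y |^2 leaves
    2 |x| |y| (|x| |y| - <x, y>), by symmetry of the real inner product. *)
Lemma rdot_le x y : rdot x y <= rnorm x * rnorm y.
Proof.
have [->|x0] := eqVneq x 0.
  by rewrite rnorm0 mul0r /rdot linear0l.
have nx : 0 < rnorm x.
  by rewrite lt_def rnorm_ge0 andbT; apply: contraNneq x0 => /rnorm_eq0/eqP.
have [->|y0] := eqVneq y 0.
  by rewrite rnorm0 mulr0 /rdot linear0r.
have ny : 0 < rnorm y.
  by rewrite lt_def rnorm_ge0 andbT; apply: contraNneq y0 => /rnorm_eq0/eqP.
have := sqr_ge0 (rnorm ((rnorm y)%:C%C *: x - (rnorm x)%:C%C *: y)).
rewrite -rdotxx !(rdotBl, rdotBr, rdotZl, rdotZr) !rdotxx (rdotC y x) => h.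
suff : 0 <= 2 * (rnorm x * rnorm y) * (rnorm x * rnorm y - rdot x y).
  by rewrite pmulr_rge0 ?subr_ge0// !mulr_gt0.
by apply: le_trans h _; rewrite le_eqVlt; apply/orP; left; apply/eqP; ring.
Qed.

(** Rotating x by the conjugate of <x, y> makes the inner product real, which
    reduces the complex Cauchy-Schwarz inequality to the real one. *)
Lemma hdot_le x y : cmod (hdot x y) <= rnorm x * rnorm y.
Proof.
have [->|z0] := eqVneq (hdot x y) 0.
  by rewrite /cmod normr0/= mulr_ge0 ?rnorm_ge0.
set z := hdot x y in z0 *.
have c0 : cmod z != 0 by apply: contra_neq z0 => c0; apply/normr0_eq0; rewrite cmodE c0.
have nz : cmod (z^*)%C != 0 by rewrite cmodJ.
have := rdot_le ((z^*)%C *: x) y.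
rewrite rnormZ cmodJ /rdot hdotZl -/z mulrC -sqr_normc cmodE -rmorphXn/= expr2.
by rewrite -mulrA ler_pM2l// lt_def c0 cmod_ge0.
Qed.

End RealGeometry.

(** * Convergence in terms of the real norm *)

Section Limits.
Local Open Scope classical_set_scope.
Context {R : realType} {H : hilbertType R}.
Implicit Types (x y z : H) (u : nat -> H) (b : nat -> R).

Lemma cvg_rnormP u x : u @ \oo --> x <->
  forall e : R, 0 < e -> \forall n \near \oo, rnorm (x - u n) < e.
Proof.
split=> [/cvgrPdist_lt ux e e0|ux].
  have := ux e%:C%C; rewrite ltcR => /(_ e0); apply: filterS => n /=.
  by rewrite rnormE ltcR.
apply/cvgrPdist_lt => e; rewrite ltcE => /andP[/eqP eI eR].
have {eI}-> : e = (complex.Re e)%:C%C by case: e eI {eR} => a c /= ->.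
by apply: filterS (ux _ eR) => n /=; rewrite rnormE ltcR.
Qed.

Lemma cvg_rnorm_squeeze u b x : b @ \oo --> (0 : R) ->
  (forall n, rnorm (x - u n) <= b n) -> u @ \oo --> x.
Proof.
move=> b0 ub; apply/cvg_rnormP => e e0; near=> n.
apply: le_lt_trans (ub n) _; near: n.
exact: (cvgr_lt (0 : R)).
Unshelve. all: by end_near. Qed.

Lemma cvg_rnorm u x : u @ \oo --> x -> rnorm (x - u n) @[n --> \oo] --> (0 : R).
Proof.
move=> /cvg_rnormP ux; apply/cvgr0Pnorm_lt => e e0.
by apply: filterS (ux _ e0) => n; rewrite ger0_norm ?rnorm_ge0.
Qed.

(** Completeness, for Cauchy sequences whose distances are bounded by a sum of
    two vanishing terms: both the minimizing sequence of Riesz representation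
    and the iteration for the square root have this form. *)
Lemma cvg_of_tail_bound u b : b @ \oo --> (0 : R) ->
  (forall m n, rnorm (u m - u n) <= b m + b n) -> exists x, u @ \oo --> x.
Proof.
move=> b0 ub; suff /cauchy_cvg uc : cauchy (u @ \oo) by exists (lim (u @ \oo)).
apply: cauchy_exP => e; rewrite ltcE => /andP[/eqP eI /= eR].
have {eI}-> : e = (complex.Re e)%:C%C by case: e eI {eR} => a c /= ->.
have e2 : 0 < complex.Re e / 2 by rewrite divr_gt0.
have [N _ bN] : \forall n \near \oo, b n < complex.Re e / 2 by exact: (cvgr_lt (0 : R)).
exists (u N); exists N => // n /= Nn.
rewrite -ball_normE /= rnormE ltcR.
apply: le_lt_trans (ub _ _) _; rewrite [ltRHS](splitr (complex.Re e)).
by apply: ltrD; apply: bN => /=.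
Qed.

Lemma norm_rdot_le x y : `|rdot x y| <= rnorm x * rnorm y.
Proof. by rewrite ler_norml rdot_le lerNl -rdotNl (le_trans (rdot_le _ _))// rnormN. Qed.

Lemma cvg_real_squeeze (v b : nat -> R) (l : R) : b @ \oo --> (0 : R) ->
  (forall n, `|l - v n| <= b n) -> v @ \oo --> l.
Proof.
move=> b0 vb; apply/cvgrPdist_lt => e e0; near=> n.
apply: le_lt_trans (vb n) _; near: n.
exact: (cvgr_lt (0 : R)).
Unshelve. all: by end_near. Qed.

Lemma cvg_rdot u x z : u @ \oo --> x -> rdot (u n) z @[n --> \oo] --> rdot x z.
Proof.
move=> /cvg_rnorm ux.
apply: (@cvg_real_squeeze _ (fun n => rnorm (x - u n) * rnorm z)).
  by rewrite -(mul0r (rnorm z)); apply: cvgMl.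
by move=> n; rewrite -rdotBl norm_rdot_le.
Qed.

Lemma rnorm_cvg_le u x (c : R) :
  u @ \oo --> x -> (forall n, rnorm (u n) <= c) -> rnorm x <= c.
Proof.
move=> /cvg_rnormP ux uc; apply/ler_addgt0Pr => e e0.
have [N _ /(_ N (leqnn N)) uN] := ux _ e0.
have := rnormD (u N) (x - u N); rewrite addrC subrK => /le_trans; apply.
by rewrite lerD// ltW.
Qed.

End Limits.

(** * Riesz representation and adjoints *)

Section Riesz.
Local Open Scope classical_set_scope.
Context {R : realType} {H : hilbertType R}.
Variables (f : H -> R) (c : R).
Hypothesis f_lin : forall (a : R) x y, f (x + a%:C%C *: y) = f x + a * f y.
Hypothesis f_le : forall x, f x <= c * rnorm x.

Let energy z := rnorm z ^+ 2 - 2 * f z.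

Lemma energy_ge z : - c ^+ 2 <= energy z.
Proof.
rewrite /energy; have := f_le z; have := sqr_ge0 (rnorm z - c).
rewrite sqrrB; nra.
Qed.

Lemma energyD (t : R) z h : energy (z + t%:C%C *: h) =
  energy z + 2 * t * (rdot z h - f h) + t ^+ 2 * rnorm h ^+ 2.
Proof.
rewrite /energy -!rdotxx !(rdotDl, rdotDr, rdotZl, rdotZr) f_lin (rdotC h z).
by ring.
Qed.

(** At an e^2-almost minimizer z, the polynomial [energyD] in t cannot drop
    below the value at t = 0 by more than e^2, which bounds its slope. *)
Lemma riesz_approx (e : R) : 0 < e ->
  exists z, forall h, `|rdot z h - f h| <= e * rnorm h.
Proof.
move=> e0.
have J_inf : has_inf (range energy).
  split; first by exists (energy 0), 0.
  by exists (- c ^+ 2) => _ [z _ <-]; exact: energy_ge.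
have [_ [z _ <-] zinf] := inf_adherent (exprn_gt0 2 e0) J_inf.
exists z => h; have min t : 0 <= e ^+ 2 + 2 * t * (rdot z h - f h) + t ^+ 2 * rnorm h ^+ 2.
  have : inf (range energy) <= energy (z + t%:C%C *: h).
    by apply: ge_inf => //; case: J_inf.
  by rewrite energyD; move: zinf; lra.
set g := rdot z h - f h in min *.
have f0 : f 0 = 0.
  have := f_lin 1 0 0; rewrite scaler0 addr0; lra.
have [h0|h0] := eqVneq (rnorm h) 0.
  by rewrite /g (rnorm_eq0 h h0) f0 /rdot linear0r/= subr0 normr0 rnorm0 mulr0.
have hp : 0 < rnorm h by rewrite lt_def h0 rnorm_ge0.
rewrite -(@ler_pXn2r _ 2)// ?nnegrE ?mulr_ge0 ?rnorm_ge0 ?(ltW e0)//.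
rewrite real_normK ?num_real// exprMn.
set k := rnorm h in h0 hp min *.
(* the variation [min] at its minimizing parameter t = - g / k ^+ 2 *)
have -> : e ^+ 2 * k ^+ 2 = g ^+ 2 + k ^+ 2 *
    (e ^+ 2 + 2 * (- g / k ^+ 2) * g + (- g / k ^+ 2) ^+ 2 * k ^+ 2) by field.
by rewrite lerDl mulr_ge0 ?sqr_ge0.
Qed.

(** The approximate representers are Cauchy: testing two of them against their
    difference h bounds |h|^2 by the sum of their errors times |h|. *)
Lemma riesz : exists s, forall h, f h = rdot h s.
Proof.
have /choice[u uf] : forall n, exists z, forall h, `|rdot z h - f h| <= harmonic n * rnorm h.
  by move=> n; apply: riesz_approx; rewrite harmonic_gt0.
have [m n|s us] := @cvg_of_tail_bound R H u _ (@cvg_harmonic R).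
  set h := u m - u n; have : rnorm h ^+ 2 <= (harmonic m + harmonic n) * rnorm h.
    rewrite -rdotxx {1}/h rdotBl -(subrKA (f h)) mulrDl.
    rewrite (le_trans (ler_norm _))// (le_trans (ler_normD _ _))// lerD//.
    by rewrite distrC.
  have := rnorm_ge0 h; have := @harmonic_ge0 R m; have := @harmonic_ge0 R n.
  rewrite le_eqVlt => h1 h2; rewrite le_eqVlt => /orP[/eqP <- _|h0].
    by rewrite addr_ge0// harmonic_ge0.
  by rewrite expr2 ler_pM2r.
exists s => h; rewrite rdotC.
rewrite -(cvg_lim (@Rhausdorff R) (cvg_rdot _ _ h us)).
apply/esym/cvg_lim; first exact: Rhausdorff.
apply: (@cvg_real_squeeze _ _ (fun n => harmonic n * rnorm h)).
  by rewrite -(mul0r (rnorm h)); apply: cvgMl; exact: cvg_harmonic.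
by move=> n; rewrite distrC uf.
Qed.

End Riesz.

Section Operators.
Local Open Scope classical_set_scope.
Context {R : realType} {H : hilbertType R}.
Implicit Types (x y z : H) (T S : H -> H).

(** Gives access to the theory of bundled linear maps for functions that are
    only known to be linear. *)
Definition linear_pack {T} (Tl : linear T) : {linear H -> H} :=
  HB.pack T (GRing.isLinear.Build R[i] H H *:%R T Tl).

Lemma linear_opZ T a x : linear T -> T (a *: x) = a *: T x.
Proof. by move=> Tl; exact: (linearZ_LR (linear_pack Tl)). Qed.

Lemma linear_opD T x y : linear T -> T (x + y) = T x + T y.
Proof. by move=> Tl; exact: (linearD (linear_pack Tl)). Qed.

Lemma linear_opB T x y : linear T -> T (x - y) = T x - T y.
Proof. by move=> Tl; exact: (linearB (linear_pack Tl)). Qed.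

Lemma rnorm_bound T : bounded_operator T ->
  exists2 M : R, 0 < M & forall x, rnorm (T x) <= M * rnorm x.
Proof.
move=> [Tl /(linear_boundedP (linear_pack Tl))/pinfty_ex_gt0[M M0 TM]].
move: M0; rewrite ltcE => /andP[/eqP MI /= M0]; exists (complex.Re M) => // x.
have := TM x; rewrite !rnormE; have -> : M = (complex.Re M)%:C%C.
  by case: M MI {TM M0} => a c /= ->.
by rewrite -rmorphM lecR.
Qed.

Lemma bounded_operator_rnorm T (M : R) : linear T ->
  (forall x, rnorm (T x) <= M * rnorm x) -> bounded_operator T.
Proof.
move=> Tl TM; split=> //; apply/ex_bound; exists (`|M|)%:C%C.
apply/nbhs_norm0P; exists 1 => //= x /=.
rewrite !rnormE -[1]/(1%:C%C) ltcR lecR => x1.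
apply: le_trans (TM x) _; apply: le_trans (ler_wpM2r (rnorm_ge0 _) (ler_norm _)) _.
by rewrite ler_piMr// ltW.
Qed.

(** The imaginary part of an inner product is, up to sign, the real part after
    multiplying the first argument by i; linearity of T over the complex
    numbers is what recovers it from [rdot]. *)
Lemma hdot_rdot T y s : linear T ->
  (forall x, rdot (T x) y = rdot x s) -> forall x, hdot (T x) y = hdot x s.
Proof.
move=> Tl Ts x.
have := Ts ('i%C *: x).
rewrite linear_opZ// /rdot !hdotZl ![_ * hdot _ _]mulrC !ReiNIm.
move/oppr_inj; have := Ts x; rewrite /rdot.
by case: (hdot _ _) => a b; case: (hdot _ _) => c d /= -> ->.
Qed.

Lemma rdot_inj y z : (forall x, rdot x y = rdot x z) -> y = z.
Proof.
move=> yz; apply/eqP; rewrite -subr_eq0; apply/eqP/rnorm_eq0/eqP.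
by rewrite -sqrf_eq0 -rdotxx rdotBr yz subrr.
Qed.

Lemma hdot_inj y z : (forall x, hdot x y = hdot x z) -> y = z.
Proof. by move=> yz; apply: rdot_inj => x; rewrite /rdot yz. Qed.

(** From |S x|^2 = <T (S x), x> <= M |S x| |x|, dividing by |S x|. *)
Lemma adjoint_bound T S (M : R) : (forall x y, hdot (T x) y = hdot x (S y)) ->
  (forall x, rnorm (T x) <= M * rnorm x) -> forall x, rnorm (S x) <= M * rnorm x.
Proof.
move=> TS TM x; have [S0|S0] := eqVneq (rnorm (S x)) 0.
  have := TM x; rewrite S0; have := rnorm_ge0 x; rewrite le_eqVlt.
  move=> /orP[/eqP <-|x0]; first by rewrite mulr0.
  by move=> /(le_trans (rnorm_ge0 _)).
have Sp : 0 < rnorm (S x) by rewrite lt_def S0 rnorm_ge0.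
rewrite -(ler_pM2l Sp) -expr2 -rdotxx /rdot -TS.
apply: le_trans (rdot_le _ _) _.
by rewrite mulrA [_ * M]mulrC ler_wpM2r// rnorm_ge0.
Qed.

Lemma linear_adjoint T S : (forall x y, hdot (T x) y = hdot x (S y)) -> linear S.
Proof.
move=> TS a y z; apply: hdot_inj => x.
by rewrite -TS !linearDr/= !hdotZr -!TS.
Qed.

Lemma adjoint_exists T : bounded_operator T -> exists S, is_adjoint T S.
Proof.
move=> Tb; have [M M0 TM] := rnorm_bound _ Tb; have [Tl _] := Tb.
have /choice[S TS] : forall y, exists s, forall x, hdot (T x) y = hdot x s.
  move=> y; have [||s fs] := @riesz R H (fun x => rdot (T x) y) (M * rnorm y).
  - move=> a x z; by rewrite linear_opD// linear_opZ// rdotDl rdotZl.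
  - move=> x; apply: le_trans (rdot_le _ _) _.
    by rewrite mulrAC ler_wpM2r// rnorm_ge0.
  - by exists s; apply: hdot_rdot.
exists S; split=> [|x y]; last exact: TS.
apply: (@bounded_operator_rnorm _ M); first by apply: (@linear_adjoint T) => x y.
by apply: (@adjoint_bound T) => // x y.
Qed.

Lemma adjointP T : bounded_operator T -> is_adjoint T (adjoint T).
Proof. by move=> /adjoint_exists; exact: getPex. Qed.

End Operators.

(** * Square roots of positive operators *)

Section SquareRoot.
Local Open Scope classical_set_scope.
Context {R : realType} {H : hilbertType R}.
Variable B : H -> H.
Hypothesis B_lin : linear B.
Hypothesis B_self : forall x y, rdot (B x) y = rdot x (B y).
Hypothesis B_le : forall x, rnorm (B x) <= rnorm x.

Let half : R[i] := (2^-1 : R)%:C%C.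

Fixpoint root_iter n (x : H) : H :=
  if n is m.+1 then half *: (B x + root_iter m (root_iter m x)) else 0.

(** The recursion of [root_iter] for the scalar 1 in place of B; it increases
    and stays below its fixed point 1. *)
Fixpoint root_bound n : R :=
  if n is m.+1 then 2^-1 * (1 + root_bound m ^+ 2) else 0.

Local Notation Y := root_iter.
Local Notation t := root_bound.

Lemma root_bound_ge0_le1 n : 0 <= t n <= 1.
Proof. by elim: n => [|n /andP[t0 t1]] /=; [rewrite lexx ler01 | apply/andP; split; nra]. Qed.

Lemma root_bound_step n : t n <= t n.+1.
Proof. by rewrite /=; have := sqr_ge0 (t n - 1); rewrite sqrrB; lra. Qed.

Lemma root_iter_linear n : linear (Y n).
Proof.
elim: n => [|n IH] a x y /=; first by rewrite scaler0 addr0.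
rewrite B_lin !IH scalerA mulrC -scalerA -scalerDr; congr (half *: _).
by rewrite scalerDr addrACA.
Qed.

Lemma root_iter_self n x y : rdot (Y n x) y = rdot x (Y n y).
Proof.
elim: n x y => [|n IH] x y /=; first by rewrite /rdot linear0l linear0r.
by rewrite rdotZl rdotZr rdotDl rdotDr B_self !IH.
Qed.

Lemma rnorm_half (x : H) : rnorm (half *: x) = 2^-1 * rnorm x.
Proof. by rewrite rnormZ cmod_real// invr_ge0. Qed.

Lemma root_iter_le n x : rnorm (Y n x) <= t n * rnorm x.
Proof.
elim: n x => [|n IH] x /=; first by rewrite rnorm0 mul0r.
rewrite rnorm_half -mulrA ler_pM2l ?invr_gt0// mulrDl mul1r.
apply: le_trans (rnormD _ _) _; apply: lerD => //.
apply: le_trans (IH _) _; rewrite expr2 -mulrA ler_wpM2l//.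
by case/andP: (root_bound_ge0_le1 n).
Qed.

(** Y^2 - Z^2 = Y (Y - Z) + (Y - Z) Z needs no commutation, and the matching
    identity for the scalars t_n turns the bound at n into the one at n + 1. *)
Lemma root_iter_step n x : rnorm (Y n.+1 x - Y n x) <= (t n.+1 - t n) * rnorm x.
Proof.
elim: n x => [|n IH] x.
  rewrite subr0 [Y 1 x]/= addr0 rnorm_half /= expr0n/= !(addr0, subr0) mulr1.
  by rewrite ler_pM2l ?invr_gt0.
have -> : Y n.+2 x - Y n.+1 x =
    half *: (Y n.+1 (Y n.+1 x - Y n x) + (Y n.+1 (Y n x) - Y n (Y n x))).
  rewrite (linear_opB (Y n.+1)); last exact: root_iter_linear.
  rewrite addrA subrK.
  by rewrite -scalerBr opprD addrACA subrr add0r.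
rewrite rnorm_half.
have -> : (t n.+2 - t n.+1) * rnorm x =
    2^-1 * (t n.+1 * ((t n.+1 - t n) * rnorm x) + (t n.+1 - t n) * (t n * rnorm x)).
  by rewrite /=; field.
rewrite ler_pM2l ?invr_gt0//; apply: le_trans (rnormD _ _) _; apply: lerD.
  apply: le_trans (root_iter_le _ _) _; rewrite ler_wpM2l//.
  by case/andP: (root_bound_ge0_le1 n.+1).
apply: le_trans (IH _) _; rewrite ler_wpM2l ?root_iter_le//.
by rewrite subr_ge0 root_bound_step.
Qed.

Lemma root_iter_dist m n x :
  rnorm (Y (m + n) x - Y m x) <= (t (m + n) - t m) * rnorm x.
Proof.
elim: n => [|n IH]; first by rewrite addn0 !subrr rnorm0 mul0r.
rewrite addnS -(subrKA (Y (m + n) x)) -(subrKA (t (m + n))) mulrDl.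
by apply: le_trans (rnormD _ _) _; rewrite lerD// root_iter_step.
Qed.

Lemma root_iter_cvg : exists Q, forall x, Y n x @[n --> \oo] --> (Q x : H).
Proof.
have t_mono : nondecreasing_seq t by apply/nondecreasing_seqP => n; exact: root_bound_step.
have t_cvg : cvgn t.
  apply: nondecreasing_is_cvgn => //; exists 1 => _ [n _ <-].
  by case/andP: (root_bound_ge0_le1 n).
pose b n := limn t - t n.
have b_ge0 n : 0 <= b n by rewrite subr_ge0; apply: nondecreasing_cvgn_le.
have b_cvg : b @ \oo --> (0 : R).
  by rewrite -(subrr (limn t)); apply: cvgB => //; exact: cvg_cst.
suff /choice[Q YQ] : forall x, exists q : H, Y n x @[n --> \oo] --> q by exists Q.
move=> x.
apply: (@cvg_of_tail_bound _ _ _ (fun n => b n * rnorm x)).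
  by rewrite -(mul0r (rnorm x)); apply: cvgMl.
suff dist m n : (m <= n)%N -> rnorm (Y n x - Y m x) <= b m * rnorm x + b n * rnorm x.
  move=> m n; have [/dist|/ltnW/dist] := leqP m n; first by rewrite rnormBC.
  by rewrite [leRHS]addrC.
move=> mn; rewrite -(subnKC mn); apply: le_trans (root_iter_dist _ _ _) _.
rewrite -mulrDl ler_wpM2r ?rnorm_ge0// subnKC//.
by have := b_ge0 n; rewrite /b; lra.
Qed.

(** The pointwise limit Q of the iterates satisfies (1 - Q)^2 = 1 - B. *)
Lemma root_complement_exists : exists Q : H -> H,
  [/\ linear Q, forall x y, rdot (Q x) y = rdot x (Q y),
      forall x, rnorm (Q x) <= rnorm x & forall x, Q x + Q x = B x + Q (Q x)].
Proof.
have [Q YQ] := root_iter_cvg; exists Q.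
have Hh : hausdorff_space H by exact: norm_hausdorff.
have Y_le n x : rnorm (Y n x) <= rnorm x.
  apply: le_trans (root_iter_le n x) _; rewrite ler_piMl ?rnorm_ge0//.
  by case/andP: (root_bound_ge0_le1 n).
split.
- move=> a x y; rewrite -(cvg_lim Hh (YQ _)); apply: cvg_lim => //.
  under eq_fun do rewrite root_iter_linear.
  by apply: cvgD => //; apply: cvgZr.
- move=> x y; rewrite -(cvg_lim (@Rhausdorff R) (cvg_rdot _ _ y (YQ x))).
  apply: cvg_lim; first exact: Rhausdorff.
  under eq_fun do rewrite root_iter_self rdotC.
  by rewrite rdotC; exact: cvg_rdot.
- by move=> x; apply: rnorm_cvg_le (YQ x) _.
- move=> x.
  have YYQ : Y n (Y n x) @[n --> \oo] --> Q (Q x).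
    (* the iterates are contractions, so Y_n (Y_n x - Q x) vanishes *)
    rewrite -[Q (Q x)]addr0.
    rewrite (_ : (fun n => _) = (fun n => Y n (Q x) + (Y n (Y n x) - Y n (Q x)))); last first.
      by apply/funext => n; rewrite addrC subrK.
    apply: cvgD => //; apply: cvg_rnorm_squeeze (cvg_rnorm _ _ (YQ x)) _ => n.
    rewrite sub0r rnormN -(linear_opB (Y n)); last exact: root_iter_linear.
    by rewrite rnormBC.
  have QE : Q x = half *: (B x + Q (Q x)).
    have YS : Y n x @[n --> \oo] --> half *: (B x + Q (Q x)).
      by rewrite -cvg_shiftS/=; apply: cvgZr; apply: cvgD => //; exact: cvg_cst.
    by rewrite -[LHS](cvg_lim Hh (YQ x)); apply: cvg_lim.
  have half2 : half + half = 1.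
    by rewrite /half -rmorphD/= (_ : 2^-1 + 2^-1 = 1 :> R) ?rmorph1//; lra.
  by rewrite {1 2}QE -scalerDl half2 scale1r.
Qed.

End SquareRoot.

Section Modulus.
Context {R : realType} {H : hilbertType R}.
Implicit Types (x y z : H) (T S : H -> H).

(** Rescaling T to a contraction makes B = 1 - T* T / M^2 a contraction:
    |B x|^2 = |x|^2 - 2 |T x|^2 / M^2 + |T* T x|^2 / M^4 <= |x|^2, where
    <T* T x, x> = |T x|^2 and the bound M of T* control the last two terms. *)
Lemma square_root_exists T : bounded_operator T ->
  exists Q, positive_operator Q /\ Q \o Q = adjoint T \o T.
Proof.
move=> Tb; have [[Sb TS] Tl] := (adjointP _ Tb, proj1 Tb).
set S := adjoint T in Sb TS *; have Sl := proj1 Sb.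
have [M M0 TM] := rnorm_bound _ Tb.
have SM := adjoint_bound _ _ _ TS TM.
have Mn0 : M != 0 by rewrite gt_eqF.
pose B x := x - (M ^- 2)%:C%C *: S (T x).
have rTS x y : rdot (T x) y = rdot x (S y) by rewrite /rdot TS.
have rST x y : rdot (S x) y = rdot x (T y) by rewrite rdotC -rTS rdotC.
have B_lin : linear B.
  move=> a x y; rewrite /B (linear_opD T)// (linear_opZ T)// (linear_opD S)// (linear_opZ S)//.
  by rewrite scalerDr opprD addrACA scalerBr !scalerA mulrC.
have B_self x y : rdot (B x) y = rdot x (B y).
  by rewrite rdotBl rdotBr rdotZl rdotZr rST rTS.
have B_le x : rnorm (B x) <= rnorm x.
  rewrite -(@ler_pXn2r _ 2)// ?nnegrE ?rnorm_ge0// -!rdotxx.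
  rewrite !(rdotBl, rdotBr, rdotZl, rdotZr) (rdotC x) rST !rdotxx.
  have ST_le : M ^- 2 * rnorm (S (T x)) ^+ 2 <= rnorm (T x) ^+ 2.
    rewrite mulrC ler_pdivrMr ?exprn_gt0// mulrC -exprMn.
    by rewrite ler_pXn2r ?nnegrE ?rnorm_ge0// mulr_ge0 ?rnorm_ge0// ltW.
  have Mi : 0 < M ^- 2 by rewrite invr_gt0 exprn_gt0.
  have := sqr_ge0 (rnorm (T x)); nra.
have [Y [Y_lin Y_self Y_le YE]] := root_complement_exists _ B_lin B_self B_le.
pose Q x := M%:C%C *: (x - Y x); exists Q.
have Q_lin : linear Q.
  move=> a x y; rewrite /Q (linear_opD Y)// (linear_opZ Y)//.
  by rewrite opprD addrACA -scalerBr scalerDr !scalerA mulrC.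
split; last first.
  apply/funext => x; rewrite /Q /=.
  rewrite (linear_opZ Y)// (linear_opB Y)// -scalerBr scalerA opprB.
  rewrite (_ : _ + _ = (M ^- 2)%:C%C *: S (T x)).
    rewrite scalerA -!rmorphM/= (_ : M * M * M ^- 2 = 1); last by field.
    by rewrite rmorph1 scale1r.
  have -> : Y (Y x) = Y x + Y x - B x by rewrite YE addrAC subrr add0r.
  by rewrite [Y x + Y x - _ - _]addrAC addrK subrKA subKr.
split.
  apply: (@bounded_operator_rnorm _ _ _ (M * 2)) => // x.
  rewrite /Q rnormZ cmod_real ?(ltW M0)// -mulrA ler_pM2l//.
  apply: le_trans (rnormD _ _) _; rewrite rnormN.
  by have := Y_le x; lra.
move=> x; rewrite lecE /=; apply/andP; split.
  (* Q is self-adjoint, so its quadratic form equals its own conjugate *)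
  have /(_ x) hQ : forall y, hdot (Q y) x = hdot y (Q x).
    apply: hdot_rdot => // y.
    by rewrite /Q rdotZl rdotZr rdotBl rdotBr Y_self.
  have := hdotC (Q x) x; rewrite -hQ; case: (hdot _ _) => a b [] /=.
  by move=> ?; apply/eqP; lra.
rewrite -/(rdot (Q x) x) /Q rdotZl mulr_ge0 ?(ltW M0)// rdotBl subr_ge0.
rewrite rdotxx; apply: le_trans (rdot_le _ _) _.
by rewrite expr2 ler_wpM2r// rnorm_ge0.
Qed.

Lemma abs_operator_sqr T : bounded_operator T ->
  abs_operator T \o abs_operator T = adjoint T \o T.
Proof. by move=> /square_root_exists/getPex[]. Qed.

End Modulus.

(** * Buzano's inequality and the numerical radius *)

Section NumericalRadius.
Local Open Scope classical_set_scope.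
Context {R : realType} {H : hilbertType R}.
Implicit Types (x y z : H) (T S : H -> H).

Lemma rnorm_reflection (a e : H) : rnorm e = 1 ->
  rnorm ((2 * hdot a e) *: e - a) = rnorm a.
Proof.
move=> e1; apply/eqP; rewrite -(@eqrXn2 _ 2) ?rnorm_ge0//; apply/eqP.
rewrite -!rdotxx rdotBl !rdotBr (rdotC a (_ *: _)) ![rdot (_ *: _) _]/rdot.
rewrite !hdotZl hdotZr hdotxx e1 expr1n mulr1 (hdotC a e).
case: (hdot a e) => u v /=.
ring.
Qed.

(** 2 <a, e> e - a is the reflection of a in the line of e and has the norm of
    a; Cauchy-Schwarz for it and b is Buzano's inequality. *)
Lemma buzano (a b e : H) : rnorm e = 1 ->
  2 * cmod (hdot a e * hdot e b) <= rnorm a * rnorm b + cmod (hdot a b).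
Proof.
move=> e1; have := hdot_le ((2 * hdot a e) *: e - a) b.
rewrite rnorm_reflection// => h.
have c2 : cmod 2 = 2 :> R by rewrite -[2 in LHS](rmorph_nat (real_complex R)) cmod_real.
rewrite -{1}c2 -cmodM mulrA.
have -> : 2 * hdot a e * hdot e b = hdot ((2 * hdot a e) *: e - a) b + hdot a b.
  by rewrite -hdotZl -hdotDl subrK.
by apply: le_trans (cmodD _ _) _; rewrite lerD2r.
Qed.

Lemma norm1_rnorm x : `|x| = 1 -> rnorm x = 1.
Proof. by rewrite /rnorm => ->. Qed.

(** Nonnegativity of c is what the zero space requires, where the supremum is
    taken over the empty set. *)
Lemma numerical_radius_le T (c : R) : 0 <= c ->
  (forall x, rnorm x = 1 -> cmod (hdot (T x) x) <= c) -> numerical_radius T <= c.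
Proof.
move=> c0 Tc; rewrite /numerical_radius; set A := [set _ | _ in _].
have [->|/set0P A0] := eqVneq A set0; first by rewrite sup0.
by apply: ge_sup => // _ [x /= /norm1_rnorm x1 <-]; exact: Tc.
Qed.

(** A bound c ensures that the supremum is that of a bounded set and not a
    default value. *)
Lemma numerical_radius_ge T (c : R) x :
  (forall y, rnorm y = 1 -> cmod (hdot (T y) y) <= c) ->
  rnorm x = 1 -> cmod (hdot (T x) x) <= numerical_radius T.
Proof.
move=> Tc x1; apply: ub_le_sup.
  by exists c => _ [y /= /norm1_rnorm y1 <-]; exact: Tc.
by exists x => //=; rewrite rnormE x1.
Qed.

Lemma adjoint_sym T S : (forall x y, hdot (T x) y = hdot x (S y)) ->
  forall x y, hdot (S x) y = hdot x (T y).
Proof. by move=> TS x y; rewrite hdotC -TS -hdotC. Qed.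

Lemma cmod_complex (p q : R) : cmod (p%:C%C + 'i%C * q%:C%C) ^+ 2 = p ^+ 2 + q ^+ 2.
Proof. by rewrite sqr_cmod /= !mul0r; ring. Qed.

(** (p + q)^2 <= 2 (p^2 + q^2), with equality for p = q. *)
Lemma add_le_cmod (p q : R) : p + q <= Num.sqrt 2 * cmod (p%:C%C + 'i%C * q%:C%C).
Proof.
apply: le_trans (ler_norm _) _.
rewrite -(@ler_pXn2r _ 2)// ?nnegrE ?mulr_ge0 ?cmod_ge0 ?sqrtr_ge0//.
rewrite exprMn sqr_sqrtr// cmod_complex real_normK ?num_real//.
by have := sqr_ge0 (p - q); rewrite sqrrB sqrrD; lra.
Qed.

End NumericalRadius.

Theorem corollary2p3 (R : realType) (H : hilbertType R) (T : H -> H)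
    (T_bounded : bounded_operator T) :
  numerical_radius T <=
    2^-1 * Num.sqrt
      (Num.sqrt 2 *
         numerical_radius
           ((abs_operator T \o abs_operator T)
            + 'i%C *: (abs_operator (adjoint T) \o abs_operator (adjoint T)))
       + 2 * numerical_radius (T \o T)).
Proof.
have [[Sb TS] [M M0 TM]] := (adjointP _ T_bounded, rnorm_bound _ T_bounded).
set S := adjoint T in Sb TS *.
have SM := adjoint_bound _ _ _ TS TM.
have [_ ST] := adjointP _ Sb.
rewrite !abs_operator_sqr// -/S; set A := (X in Num.sqrt 2 * numerical_radius X).
have AE x : hdot (A x) x = (rnorm (T x) ^+ 2)%:C%C + 'i%C * (rnorm (S x) ^+ 2)%:C%C.
  have -> : A x = S (T x) + 'i%C *: adjoint S (S x) by [].
  by rewrite hdotDl hdotZl (adjoint_sym _ _ TS) (adjoint_sym _ _ ST) !hdotxx.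
have A_ub x : rnorm x = 1 -> cmod (hdot (A x) x) <= M ^+ 2 + M ^+ 2.
  move=> x1; have := TM x; have := SM x; rewrite x1 !mulr1 => Sx Tx.
  rewrite AE; apply: le_trans (cmodD _ _) _.
  have i1 : cmod 'i%C = 1 :> R by rewrite /cmod normc_def /= expr0n expr1n add0r sqrtr1.
  rewrite cmodM i1 mul1r !cmod_real ?sqr_ge0//.
  by apply: lerD; rewrite ler_pXn2r ?nnegrE ?rnorm_ge0// ltW.
have TT_ub x : rnorm x = 1 -> cmod (hdot (T (T x)) x) <= M ^+ 2.
  move=> x1; apply: le_trans (hdot_le _ _) _; rewrite x1 mulr1.
  have := TM x; rewrite x1 mulr1 => Tx; apply: le_trans (TM _) _.
  by rewrite expr2 ler_pM2l.
apply: numerical_radius_le => [|x x1]; first by rewrite mulr_ge0 ?invr_ge0 ?sqrtr_ge0.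
rewrite ler_pdivlMl//; apply: le_trans (ler_norm _) _.
rewrite -sqrtr_sqr ler_wsqrtr//.
have Ax := numerical_radius_ge _ _ _ A_ub x1.
have TTx := numerical_radius_ge _ _ _ TT_ub x1.
have bz := buzano (T x) (S x) x x1.
rewrite -!TS cmodM -expr2 in bz.
have pq := add_le_cmod (rnorm (T x) ^+ 2) (rnorm (S x) ^+ 2).
rewrite -AE in pq.
have am := sqr_ge0 (rnorm (T x) - rnorm (S x)).
have sA : Num.sqrt 2 * cmod (hdot (A x) x) <= Num.sqrt 2 * numerical_radius A.
  by rewrite ler_wpM2l// sqrtr_ge0.
rewrite sqrrB in am; rewrite exprMn.
(* 4 |<T x, x>|^2 <= 2 |T x| |S x| + 2 |<T^2 x, x>| by [bz], then [am], [pq] *)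
rewrite -/(T \o T) in TTx; nra.
Qed.
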